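(* Let $(x,y)\in\mathcal{S}$. Then: (i) $\delta(x)=\delta(x+1)$ and $\delta(y)=\delta(y+1)$; (ii) $\delta(x)=\delta(y)$ or $\delta(x)=\delta(y)+1$. Moreover, $\mathcal{C}=\{(x,y)\in\mathcal{S} : \delta(x)=\delta(y)+1\}$.
   Context: For a positive real number $z$, $\delta(z)=\lfloor\log_{10} z\rfloor$ (so for a positive integer $z$, $\delta(z)+1$ is its number of decimal digits). $\mathcal{S}=\{(x,y)\in\mathbb{Z}^2 : x>y\ge 1,\ x(x+1)=10\,y(y+1)\}$ and $\mathcal{C}=\{(x,y)\in\mathcal{S} : \delta(x+1)=\delta(y+1)+1\}$. *)

(* Defs.v *)
(* Stdlib reals and integers. *)
From Stdlib Require Export Reals ZArith Ensembles.

(* Meaningful for [0 < z]; [Int_part] is the floor, also on negative reals. *)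
Definition delta (z : R) : Z := Int_part (Rlog 10 z).

Definition setS : Ensemble (Z * Z) :=
  fun '(x, y) => (x > y /\ y >= 1 /\ x * (x + 1) = 10 * (y * (y + 1)))%Z.

Definition setC : Ensemble (Z * Z) :=
  fun '(x, y) =>
    In _ setS (x, y) /\ delta (IZR (x + 1)) = (delta (IZR (y + 1)) + 1)%Z.

(* Main.v *)
(* [delta] changes between [n] and [n + 1] only if [n + 1] is a power of ten, so
   (i) says that neither [x + 1] nor [y + 1] is one.  If [x + 1 = 10 t] with
   [t = 10^k], then [y (y + 1) = t (10 t - 1)]; if [y + 1 = t], then
   [x (x + 1) = 10 t (t - 1)].  Either way some [z < 4 t] satisfies
   [z (z + 1) = c t (d t - 1)] with [c d = 10].  As [z] and [z + 1] are coprime,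
   [5^k] divides one of them, with a quotient [v <= 4 * 2^k], and reducing the
   equation modulo [5^k] shows that [5^k] divides [v + c 2^k] or [v - c 2^k].
   These are smaller than [5^k] in absolute value once [k >= 3], and both cases
   are absurd.  Part (ii) follows from [y < x < 10 y]. *)
Require Import Defs.
From Stdlib Require Import Reals ZArith Ensembles Znumtheory Zpow_facts Lia Lra.

Open Scope Z_scope.

(** These integer bounds determine [delta]; the lemmas below reach the logarithm only through
    them. *)
Lemma delta_bounds (n : Z) (hn : 1 <= n) :
  0 <= delta (IZR n) /\ 10 ^ delta (IZR n) <= n < 10 ^ (delta (IZR n) + 1).
Proof.
  set (d := delta (IZR n)).
  assert (Hn : (1 <= IZR n)%R) by now apply IZR_le.
  assert (H10 : (0 < ln 10)%R) by (rewrite <- ln_1; apply ln_increasing; lra).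
  assert (Hln : (0 <= ln (IZR n))%R).
  { rewrite <- ln_1. destruct Hn as [Hn|<-]; [left|lra].
    apply ln_increasing; lra. }
  assert (Hq : (Rlog 10 (IZR n) * ln 10 = ln (IZR n))%R)
    by (unfold Rlog; field; lra).
  destruct (base_Int_part (Rlog 10 (IZR n))) as [H1 H2].
  change (Int_part (Rlog 10 (IZR n))) with d in H1, H2.
  assert (Hd : 0 <= d).
  { destruct (Z_lt_le_dec d 0) as [h|h]; [exfalso|easy].
    assert (IZR d <= -1)%R by (apply IZR_le; lia). nra. }
  assert (Hpow : forall m, 0 <= m -> ln (IZR (10 ^ m)) = (IZR m * ln 10)%R).
  { intros m hm. rewrite <- (Z2Nat.id m hm) at 1.
    rewrite <- pow_IZR, ln_pow, INR_IZR_INZ, Z2Nat.id by (lra || easy).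
    reflexivity. }
  assert (Hpos : forall m, 0 <= m -> (0 < IZR (10 ^ m))%R)
    by (intros m hm; apply IZR_lt; lia).
  split; [easy|split].
  - apply le_IZR, Rnot_lt_le. intros h. apply ln_increasing in h; [|lra].
    rewrite Hpow in h by easy. nra.
  - apply lt_IZR, ln_lt_inv; [lra|apply Hpos; lia|].
    rewrite Hpow, plus_IZR by lia. nra.
Qed.

Lemma delta_le (m n : Z) (hm : 1 <= m) (hmn : m <= n) :
  delta (IZR m) <= delta (IZR n).
Proof.
  destruct (delta_bounds m) as [? [? ?]]; [easy|].
  destruct (delta_bounds n) as [? [? ?]]; [lia|].
  enough (delta (IZR m) < delta (IZR n) + 1) by lia.
  apply (Z.pow_lt_mono_r_iff 10); lia.
Qed.

Lemma delta_lt_10 (m n : Z) (hm : 1 <= m) (hn : 1 <= n) (hmn : n < 10 * m) :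
  delta (IZR n) <= delta (IZR m) + 1.
Proof.
  destruct (delta_bounds m) as [? [? ?]]; [easy|].
  destruct (delta_bounds n) as [? [? ?]]; [easy|].
  enough (delta (IZR n) < delta (IZR m) + 1 + 1) by lia.
  apply (Z.pow_lt_mono_r_iff 10); [lia..|].
  rewrite (Z.pow_add_r 10 (_ + 1) 1) by lia. lia.
Qed.

Lemma delta_succ_neq (n : Z) (hn : 1 <= n) :
  delta (IZR n) <> delta (IZR (n + 1)) ->
  exists k, 0 <= k /\ n + 1 = 10 ^ (k + 1).
Proof.
  (* [delta] can only grow, so [n < 10 ^ (delta (IZR n) + 1) <= n + 1]. *)
  intros hne. exists (delta (IZR n)).
  destruct (delta_bounds n) as [? [? ?]]; [easy|].
  destruct (delta_bounds (n + 1)) as [? [? ?]]; [lia|].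
  pose proof (delta_le n (n + 1) ltac:(easy) ltac:(lia)).
  pose proof (Z.pow_le_mono_r 10 (delta (IZR n) + 1) (delta (IZR (n + 1)))
                ltac:(lia) ltac:(lia)).
  lia.
Qed.

(** [p] cannot divide both factors, so [p ^ k] is coprime to one of them and Gauss applies. *)
Lemma pow_prime_divides_consecutive (p k z : Z) (hp : prime p) (hk : 0 <= k) :
  (p ^ k | z * (z + 1)) -> (p ^ k | z) \/ (p ^ k | z + 1).
Proof.
  intros h.
  destruct (Zdivide_dec p z) as [hz|hz].
  - left. rewrite Z.mul_comm in h. apply (Gauss _ _ _ h).
    apply rel_prime_sym, rel_prime_Zpower_r; [easy|].
    apply rel_prime_sym, prime_rel_prime; [easy|]. intros hz'.
    assert (h1 : (p | 1)) by (replace 1 with (z + 1 - z) by ring;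
                              now apply Z.divide_sub_r).
    pose proof (prime_ge_2 p hp). apply Z.divide_1_r in h1. lia.
  - right. apply (Gauss _ _ _ h).
    apply rel_prime_sym, rel_prime_Zpower_r; [easy|].
    now apply rel_prime_sym, prime_rel_prime.
Qed.

(** The constant is 4 + 10, from [v <= 4 * 2 ^ k] and [c <= 10]. The base case is 112 < 125. *)
Lemma five_pow_gt (k : Z) (hk : 3 <= k) : 14 * 2 ^ k < 5 ^ k.
Proof.
  replace k with (k - 3 + 3) by ring. rewrite !Z.pow_add_r by lia.
  pose proof (Z.pow_le_mono_l 2 5 (k - 3) ltac:(lia)). lia.
Qed.

Lemma no_consecutive_product (k c d z : Z) (hk : 0 <= k) (hz : 1 <= z)
  (hcd : c = 1 /\ d = 10 \/ c = 10 /\ d = 1) :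
  z * (z + 1) <> c * 10 ^ k * (d * 10 ^ k - 1).
Proof.
  intros E.
  destruct (Z_lt_le_dec k 3) as [hk3|hk3].
  { assert (z < 400).
    { assert (10 ^ k <= 10 ^ 2) by (apply Z.pow_le_mono_r; lia).
      change (10 ^ 2) with 100 in *.
      destruct hcd as [[-> ->]|[-> ->]]; nia. }
    assert (hk' : k = 0 \/ k = 1 \/ k = 2) by lia.
    (* The right-hand sides are 9, 0, 990, 900, 99900 and 99000; the cuts lie near their square
       roots. *)
    assert (hz' : z <= 2 \/ z = 3 \/ 4 <= z <= 28 \/ z = 29 \/ z = 30 \/ z = 31
       \/ 32 <= z <= 313 \/ z = 314 \/ 315 <= z) by lia.
    destruct hk' as [->|[->| ->]];
      [change (10 ^ 0) with 1 in E|change (10 ^ 1) with 10 in E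
       |change (10 ^ 2) with 100 in E];
      destruct hcd as [[-> ->]|[-> ->]]; nia. }
  pose proof (five_pow_gt k hk3) as hAB.
  assert (ht : 10 ^ k = 5 ^ k * 2 ^ k) by (rewrite <- Z.pow_mul_l; reflexivity).
  assert (hB : 0 < 2 ^ k) by lia.
  rewrite ht in E.
  destruct (pow_prime_divides_consecutive 5 k z) as [[v hv]|[v hv]].
  - apply prime_intro; [lia|]. intros n hn.
    assert (hn' : n = 1 \/ n = 2 \/ n = 3 \/ n = 4) by lia.
    apply Zgcd_1_rel_prime.
    destruct hn' as [->|[->|[->| ->]]]; reflexivity.
  - easy.
  - exists (c * 2 ^ k * (d * (5 ^ k * 2 ^ k) - 1)). rewrite E. ring.
  - set (A := 5 ^ k) in *; set (B := 2 ^ k) in *.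
    (* Since [c * d = 10], [z * z < 10 * (A * B) ^ 2]. *)
    assert (hz4 : z < 4 * (A * B)) by (destruct hcd as [[-> ->]|[-> ->]]; nia).
    subst z. assert (hv0 : 0 < v) by nia. assert (hv4 : v < 4 * B) by nia.
    assert (E' : v * (v * A + 1) = c * B * (d * (A * B) - 1)).
    { apply (Z.mul_reg_l _ _ A); [lia|]. lia. }
    assert (hdiv : (A | v + c * B)).
    { exists (c * d * B * B - v * v). lia. }
    apply Z.divide_pos_le in hdiv; lia.
  - set (A := 5 ^ k) in *; set (B := 2 ^ k) in *.
    assert (hz4 : z < 4 * (A * B)) by (destruct hcd as [[-> ->]|[-> ->]]; nia).
    replace z with (v * A - 1) in * by lia.
    assert (hv0 : 0 < v) by nia. assert (hv4 : v <= 4 * B) by nia.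
    assert (E' : v * (v * A - 1) = c * B * (d * (A * B) - 1)).
    { apply (Z.mul_reg_l _ _ A); [lia|]. lia. }
    assert (hdiv : (A | v - c * B)).
    { exists (v * v - c * d * B * B). lia. }
    (* Unlike the sum above, this difference may vanish; but [v = c * B] in [E'] forces [c = d]. *)
    assert (h0 : v - c * B = 0).
    { apply Z.divide_abs_r in hdiv.
      destruct (Z.eq_dec (v - c * B) 0) as [h0|h0]; [easy|].
      apply Z.divide_pos_le in hdiv; lia. }
    replace v with (c * B) in * by lia.
    destruct hcd as [[-> ->]|[-> ->]]; nia.
Qed.

Lemma setS_delta_succ (x y : Z) (h : In _ setS (x, y)) :
  delta (IZR x) = delta (IZR (x + 1)) /\ delta (IZR y) = delta (IZR (y + 1)).
Proof.
  destruct h as [hxy [hy E]]. split.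
  - destruct (Z.eq_dec (delta (IZR x)) (delta (IZR (x + 1)))) as [e|e]; [easy|].
    destruct (delta_succ_neq x ltac:(lia) e) as [k [hk hx]].
    exfalso. apply (no_consecutive_product k 1 10 y); [easy|lia|lia|].
    rewrite Z.pow_add_r in hx by lia. replace x with (10 ^ k * 10 - 1) in E by lia.
    lia.
  - destruct (Z.eq_dec (delta (IZR y)) (delta (IZR (y + 1)))) as [e|e]; [easy|].
    destruct (delta_succ_neq y ltac:(lia) e) as [k [hk hy']].
    (* Here [t] is [y + 1] itself, hence the exponent [k + 1]; for [x] one factor 10 went into
       [d]. *)
    exfalso. apply (no_consecutive_product (k + 1) 10 1 x); [lia|lia|lia|].
    rewrite <- hy', E. ring.
Qed.

Lemma setS_delta_cases (x y : Z) (h : In _ setS (x, y)) :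
  delta (IZR x) = delta (IZR y) \/ delta (IZR x) = delta (IZR y) + 1.
Proof.
  destruct h as [hxy [hy E]].
  pose proof (delta_le y x ltac:(lia) ltac:(lia)).
  (* [x >= 10 * y] would give [x * (x + 1) >= 10 * y * (10 * y + 1)], which is too large. *)
  pose proof (delta_lt_10 y x ltac:(lia) ltac:(lia) ltac:(nia)).
  lia.
Qed.

Close Scope Z_scope.

Theorem corollary1 :
  (forall x y : Z, In _ setS (x, y) ->
     (delta (IZR x) = delta (IZR (x + 1)) /\
      delta (IZR y) = delta (IZR (y + 1))) /\
     (delta (IZR x) = delta (IZR y) \/
      delta (IZR x) = (delta (IZR y) + 1)%Z)) /\
  Same_set _ setC
    (fun '(x, y) =>
       In _ setS (x, y) /\ delta (IZR x) = (delta (IZR y) + 1)%Z).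
Proof.
  split.
  - intros x y h. split; [now apply setS_delta_succ|now apply setS_delta_cases].
  (* By (i), the two conditions on [delta] are equivalent on [setS]. *)
  - split; intros [x y] [h e]; split; try exact h;
      destruct (setS_delta_succ x y h) as [hx hy]; congruence.
Qed.
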